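(* Let $\mathbf U=\langle\langle U,\approx\rangle,\preceq\rangle$ be a completely lattice $\mathbf L$-ordered set and $\langle f,g\rangle$ an extensive isotone $\mathbf L$-Galois connection on $\mathbf U$. Define $u\sim_{\langle f,g\rangle}v=(f(u)\preceq v)\wedge(v\preceq g(u))$ for $u,v\in U$. Then $\sim_{\langle f,g\rangle}$ is a complete $\mathbf L$-tolerance on $\mathbf U$ and for each $u\in U$, $u_{\sim_{\langle f,g\rangle}}=f(u)$ and $u^{\sim_{\langle f,g\rangle}}=g(u)$.
   Context: $\mathbf L=\langle L,\wedge,\vee,\otimes,\to,0,1\rangle$ is a complete residuated lattice ($\langle L,\wedge,\vee,0,1\rangle$ complete lattice, $\langle L,\otimes,1\rangle$ commutative monoid, $a\otimes b\le c$ iff $a\le b\to c$). An $\mathbf L$-set in $X$ is a map $X\to L$; $L^X$ the set of them; $S(A,B)=\bigwedge_x(A(x)\to B(x))$. An $\mathbf L$-equality is a binary $\mathbf L$-relation that is reflexive, symmetric, transitive ($R(x,y)\otimes R(y,z)\le R(x,z)$) and with $R(x,y)=1\Rightarrow x=y$. An $\mathbf L$-ordered set is $\langle\langle U,\approx\rangle,\preceq\rangle$, $\approx$ an $\mathbf L$-equality, $\preceq$ reflexive, transitive, compatible with $\approx$ ($(u\preceq v)\otimes(u\approx u')\otimes(v\approx v')\le(u'\preceq v')$), and $(u\preceq v)\wedge(v\preceq u)\le u\approx v$; $u\le v$ means $(u\preceq v)=1$. For $V\in L^U$: $\mathcal L V(v)=\bigwedge_u(V(u)\to(v\preceq u))$,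 $\mathcal U V(v)=\bigwedge_u(V(u)\to(u\preceq v))$; $\inf V$ is the unique $u$ with $\mathcal L V(u)=1=\mathcal U(\mathcal L V)(u)$, $\sup V$ the unique $u$ with $\mathcal U V(u)=1=\mathcal L(\mathcal U V)(u)$; completely lattice means these exist for all $V$. Power relation: for $R$ on $X$, $A,B\in L^X$, $(R\circ B)(x)=\bigvee_y R(x,y)\otimes B(y)$, $(A\circ R)(y)=\bigvee_x A(x)\otimes R(x,y)$, $R^+(A,B)=S(A,R\circ B)\wedge S(B,A\circ R)$. A binary $\mathbf L$-relation $R$ on $\mathbf U$ is complete if it is compatible with $\approx$ ($R(u,v)\otimes(u\approx u')\otimes(v\approx v')\le R(u',v')$) and $R^+(V_1,V_2)\le R(\inf V_1,\inf V_2)$, $R^+(V_1,V_2)\le R(\sup V_1,\sup V_2)$ for all $V_1,V_2\in L^U$. An $\mathbf L$-tolerance is a reflexive symmetric binary $\mathbf L$-relation; for an $\mathbf L$-tolerance $\sim$ and $u\in U$, $[u]_\sim(v)=u\sim v$, $u_\sim=\inf[u]_\sim$, $u^\sim=\sup[u]_\sim$. An isotone $\mathbf L$-Galois connection on $\mathbf U$ is a pair $\langle f,g\rangle$ of maps $U\to U$ with $(f(u)\preceq v)=(u\preceq g(v))$ for all $u,v$; it is extensive if $f(u)\le u$ and $g(u)\ge u$ for all $u$. *)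

(* Defs.v *)
From HB Require Import structures.
From mathcomp Require Import all_boot all_order.
From mathcomp Require Import boolp classical_sets.

Set Implicit Arguments.
Unset Strict Implicit.
Unset Printing Implicit Defensive.

Import Order.TTheory.
Local Open Scope order_scope.

(* Every type carries a choiceType structure classically, so building on
   tbLatticeType is no restriction on the underlying lattice. *)
HB.mixin Record TBLattice_isComplete d (L : Type) of Order.TBLattice d L := {
  cmeet : set L -> L;
  cjoin : set L -> L;
  cmeetP : forall A : set L, infimums A (cmeet A);
  cjoinP : forall A : set L, supremums A (cjoin A)
}.

#[short(type="completeLatticeType")]
HB.structure Definition CompleteLattice d :=
  { L of Order.TBLattice d L & TBLattice_isComplete d L }.

(* The unit of the monoid is the top element of the lattice. *)
HB.mixin Record CompleteLattice_isResiduated d (L : Type)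
    of CompleteLattice d L := {
  otimes : L -> L -> L;
  residuum : L -> L -> L;
  otimesA : associative otimes;
  otimesC : commutative otimes;
  otimes1l : left_id (\top : L) otimes;
  otimes_residuum : forall a b c : L, (otimes a b <= c) = (a <= residuum b c)
}.

#[short(type="completeResiduatedLatticeType")]
HB.structure Definition CompleteResiduatedLattice d :=
  { L of CompleteLattice d L & CompleteLattice_isResiduated d L }.

Declare Scope lset_scope.
Delimit Scope lset_scope with L.
Local Open Scope lset_scope.

Infix "⊗" := otimes (at level 40, left associativity) : lset_scope.
Infix "⇒" := residuum (at level 55, right associativity) : lset_scope.
Notation "⋀ x , F" := (cmeet (range (fun x => F)))
  (at level 65, x name, F at level 65) : lset_scope.
Notation "⋁ x , F" := (cjoin (range (fun x => F)))
  (at level 65, x name, F at level 65) : lset_scope.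

Definition lset d (L : completeResiduatedLatticeType d) (X : Type) := X -> L.
Definition lrel d (L : completeResiduatedLatticeType d) (X : Type) :=
  X -> X -> L.

Definition subsethood d (L : completeResiduatedLatticeType d) (X : Type)
  (A B : lset L X) : L := ⋀ x, (A x ⇒ B x).

Definition lreflexive d (L : completeResiduatedLatticeType d) (X : Type)
  (R : lrel L X) := forall x, R x x = \top.

Definition lsymmetric d (L : completeResiduatedLatticeType d) (X : Type)
  (R : lrel L X) := forall x y, R x y = R y x.

Definition ltransitive d (L : completeResiduatedLatticeType d) (X : Type)
  (R : lrel L X) := forall x y z, R x y ⊗ R y z <= R x z.

Definition lequality d (L : completeResiduatedLatticeType d) (X : Type)
  (R : lrel L X) :=
  [/\ lreflexive R, lsymmetric R, ltransitive R
    & forall x y, R x y = \top -> x = y].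

Definition lcompatible d (L : completeResiduatedLatticeType d) (X : Type)
  (eqv R : lrel L X) :=
  forall u u' v v', R u v ⊗ eqv u u' ⊗ eqv v v' <= R u' v'.

Record lOrderedSet d (L : completeResiduatedLatticeType d) := LOrderedSet {
  lcarrier :> Type;
  leqv : lrel L lcarrier;
  lle : lrel L lcarrier;
  leqv_equality : lequality leqv;
  lle_refl : lreflexive lle;
  lle_trans : ltransitive lle;
  lle_compat : lcompatible leqv lle;
  lle_antisym : forall u v, lle u v `&` lle v u <= leqv u v
}.

Infix "≈" := leqv (at level 50, no associativity) : lset_scope.
Infix "⪯" := lle (at level 50, no associativity) : lset_scope.

(* The crisp order induced by the L-order. *)
Definition crisp_le d (L : completeResiduatedLatticeType d)
  (U : lOrderedSet L) (u v : U) : Prop := (u ⪯ v) = \top.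

Definition lower_cone d (L : completeResiduatedLatticeType d)
  (U : lOrderedSet L) (V : lset L U) : lset L U :=
  fun v => ⋀ u, (V u ⇒ (v ⪯ u)).

Definition upper_cone d (L : completeResiduatedLatticeType d)
  (U : lOrderedSet L) (V : lset L U) : lset L U :=
  fun v => ⋀ u, (V u ⇒ (u ⪯ v)).

Definition is_linf d (L : completeResiduatedLatticeType d)
  (U : lOrderedSet L) (V : lset L U) (u : U) : Prop :=
  lower_cone V u = \top /\ upper_cone (lower_cone V) u = \top.

Definition is_lsup d (L : completeResiduatedLatticeType d)
  (U : lOrderedSet L) (V : lset L U) (u : U) : Prop :=
  upper_cone V u = \top /\ lower_cone (upper_cone V) u = \top.

(* Uniqueness of infima and suprema is a consequence: see [is_linf_uniq] and
   [is_lsup_uniq]. *)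
Record completelyLatticeLOrderedSet d (L : completeResiduatedLatticeType d) :=
  CompletelyLatticeLOrderedSet {
    lordered_base :> lOrderedSet L;
    linf_exists : forall V : lset L lordered_base, exists u, is_linf V u;
    lsup_exists : forall V : lset L lordered_base, exists u, is_lsup V u
  }.

Definition linf d (L : completeResiduatedLatticeType d)
  (U : completelyLatticeLOrderedSet L) (V : lset L U) : U :=
  projT1 (cid (linf_exists V)).

Definition lsup d (L : completeResiduatedLatticeType d)
  (U : completelyLatticeLOrderedSet L) (V : lset L U) : U :=
  projT1 (cid (lsup_exists V)).

Lemma cmeet_le d (L : completeResiduatedLatticeType d) (X : Type)
  (F : X -> L) (x : X) : (⋀ y, F y) <= F x.
Proof. by case: (cmeetP (range F)) => lb _; apply: lb; exists x. Qed.

Lemma le_cmeet d (L : completeResiduatedLatticeType d) (X : Type)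
  (F : X -> L) (a : L) : (forall x, a <= F x) -> a <= (⋀ y, F y).
Proof.
by move=> aF; case: (cmeetP (range F)) => _; apply => _ [x _ <-].
Qed.

Lemma residuum_top d (L : completeResiduatedLatticeType d) (a b : L) :
  (a ⇒ b = \top) <-> (a <= b).
Proof.
have -> : (a <= b) = (\top <= (a ⇒ b)) by rewrite -otimes_residuum otimes1l.
by rewrite le1x; split=> [-> // | /eqP].
Qed.

Lemma cone_top_le d (L : completeResiduatedLatticeType d) (X : Type)
  (F G : X -> L) (x : X) : (⋀ y, (F y ⇒ G y)) = \top -> F x <= G x.
Proof.
move=> FG; apply/residuum_top/eqP; rewrite -le1x -FG.
exact: (cmeet_le (fun y => F y ⇒ G y)).
Qed.

Lemma crisp_le_anti d (L : completeResiduatedLatticeType d)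
  (U : lOrderedSet L) (u v : U) : crisp_le u v -> crisp_le v u -> u = v.
Proof.
move=> uv vu; have [_ _ _ sep] := leqv_equality U; apply: sep.
by apply/eqP; rewrite -le1x (le_trans _ (lle_antisym u v))// uv vu meetxx.
Qed.

Lemma is_linf_uniq d (L : completeResiduatedLatticeType d)
  (U : lOrderedSet L) (V : lset L U) (u v : U) :
  is_linf V u -> is_linf V v -> u = v.
Proof.
move=> [Lu ULu] [Lv ULv]; apply: crisp_le_anti; apply/eqP; rewrite -le1x.
- rewrite -Lu; exact: (cone_top_le u ULv).
- rewrite -Lv; exact: (cone_top_le v ULu).
Qed.

Lemma is_lsup_uniq d (L : completeResiduatedLatticeType d)
  (U : lOrderedSet L) (V : lset L U) (u v : U) :
  is_lsup V u -> is_lsup V v -> u = v.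
Proof.
move=> [Uu LUu] [Uv LUv]; apply: crisp_le_anti; apply/eqP; rewrite -le1x.
- rewrite -Uv; exact: (cone_top_le v LUu).
- rewrite -Uu; exact: (cone_top_le u LUv).
Qed.

Lemma linfP d (L : completeResiduatedLatticeType d)
  (U : completelyLatticeLOrderedSet L) (V : lset L U) : is_linf V (linf V).
Proof. exact: projT2 (cid (linf_exists V)). Qed.

Lemma lsupP d (L : completeResiduatedLatticeType d)
  (U : completelyLatticeLOrderedSet L) (V : lset L U) : is_lsup V (lsup V).
Proof. exact: projT2 (cid (lsup_exists V)). Qed.

Definition lrel_lset d (L : completeResiduatedLatticeType d) (X : Type)
  (R : lrel L X) (B : lset L X) : lset L X := fun x => ⋁ y, (R x y ⊗ B y).

Definition lset_lrel d (L : completeResiduatedLatticeType d) (X : Type)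
  (A : lset L X) (R : lrel L X) : lset L X := fun y => ⋁ x, (A x ⊗ R x y).

Definition power_rel d (L : completeResiduatedLatticeType d) (X : Type)
  (R : lrel L X) : lrel L (lset L X) :=
  fun A B => subsethood A (lrel_lset R B) `&` subsethood B (lset_lrel A R).

Definition complete_lrel d (L : completeResiduatedLatticeType d)
  (U : completelyLatticeLOrderedSet L) (R : lrel L U) :=
  [/\ lcompatible (@leqv d L U) R,
      forall V1 V2 : lset L U, power_rel R V1 V2 <= R (linf V1) (linf V2)
    & forall V1 V2 : lset L U, power_rel R V1 V2 <= R (lsup V1) (lsup V2)].

Definition ltolerance d (L : completeResiduatedLatticeType d) (X : Type)
  (R : lrel L X) := lreflexive R /\ lsymmetric R.

Definition complete_ltolerance d (L : completeResiduatedLatticeType d)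
  (U : completelyLatticeLOrderedSet L) (R : lrel L U) :=
  ltolerance R /\ complete_lrel R.

Definition tol_class d (L : completeResiduatedLatticeType d) (X : Type)
  (R : lrel L X) (u : X) : lset L X := fun v => R u v.

Definition tol_inf d (L : completeResiduatedLatticeType d)
  (U : completelyLatticeLOrderedSet L) (R : lrel L U) (u : U) : U :=
  linf (tol_class R u).

Definition tol_sup d (L : completeResiduatedLatticeType d)
  (U : completelyLatticeLOrderedSet L) (R : lrel L U) (u : U) : U :=
  lsup (tol_class R u).

Definition isotone_lgalois d (L : completeResiduatedLatticeType d)
  (U : lOrderedSet L) (f g : U -> U) := forall u v, (f u ⪯ v) = (u ⪯ g v).

Definition extensive_lgalois d (L : completeResiduatedLatticeType d)
  (U : lOrderedSet L) (f g : U -> U) :=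
  isotone_lgalois f g /\ forall u, crisp_le (f u) u /\ crisp_le u (g u).

Definition galois_lrel d (L : completeResiduatedLatticeType d)
  (U : lOrderedSet L) (f g : U -> U) : lrel L U :=
  fun u v => (f u ⪯ v) `&` (v ⪯ g u).

(* Main.v *)
Require Import Defs.
From HB Require Import structures.
From mathcomp Require Import all_boot all_order.
From mathcomp Require Import boolp classical_sets.

(** Write P u v for f u ⪯ v, which equals u ⪯ g v by adjunction.  Then the
    relation is P u v ∧ P v u, so it is symmetric and every remaining claim is
    one about P: bounding P (inf A) (inf B) uses the form u ⪯ g v on elements of
    A, while P (sup A) (sup B) uses the form f u ⪯ v on elements of B.  The
    class of u lies between f u and g u and contains both. *)

Set Implicit Arguments.
Unset Strict Implicit.
Unset Printing Implicit Defensive.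

Import Order.TTheory.
Local Open Scope order_scope.
Local Open Scope lset_scope.

Section ResiduatedLattice.
Context d (L : completeResiduatedLatticeType d).
Implicit Types a b c : L.

Lemma cjoin_le (X : Type) (F : X -> L) a :
  (forall x, F x <= a) -> (⋁ x, F x) <= a.
Proof.
by move=> Fa; case: (cjoinP (range F)) => _; apply => _ [x _ <-].
Qed.

Lemma otimes1r a : a ⊗ \top = a.
Proof. by rewrite otimesC otimes1l. Qed.

Lemma le_otimes2r c a b : a <= b -> a ⊗ c <= b ⊗ c.
Proof.
by move=> ab; rewrite otimes_residuum (le_trans ab)// -otimes_residuum.
Qed.

Lemma le_otimes2l c a b : a <= b -> c ⊗ a <= c ⊗ b.
Proof. by move=> ab; rewrite ![c ⊗ _]otimesC le_otimes2r. Qed.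

Lemma le_otimes a b a' b' : a <= a' -> b <= b' -> a ⊗ b <= a' ⊗ b'.
Proof. by move=> aa' bb'; rewrite (le_trans (le_otimes2r b aa'))// le_otimes2l. Qed.

Lemma residuum_mono a b c : b <= c -> (a ⇒ b) <= (a ⇒ c).
Proof. by move=> bc; rewrite -otimes_residuum (le_trans _ bc)// otimes_residuum. Qed.

(** With [C x] of the form [v ⪯ x] or [x ⪯ v], the right side is a cone of [A] at [v]; this turns a
    conjunct of [power_rel] into a cone degree. *)
Lemma subsethood_le_cmeet (X : Type) (A B C : lset L X) :
  (forall x, B x <= C x) -> subsethood A B <= ⋀ x, (A x ⇒ C x).
Proof.
move=> BC; apply: le_cmeet => x.
apply: (le_trans (cmeet_le (fun x => A x ⇒ B x) x)).
exact: residuum_mono.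
Qed.

Lemma cmeet_eq_top (X : Type) (F G : X -> L) :
  (forall x, F x <= G x) -> (⋀ x, (F x ⇒ G x)) = \top.
Proof.
move=> FG; apply/eqP; rewrite -le1x; apply: le_cmeet => x.
by rewrite -otimes_residuum otimes1l.
Qed.

Lemma cmeet_residuum_le_top (X : Type) (F G : X -> L) (x : X) :
  F x = \top -> (⋀ y, (F y ⇒ G y)) <= G x.
Proof.
move=> Fx; apply: (le_trans (cmeet_le (fun y => F y ⇒ G y) x)).
by rewrite Fx -[_ ⇒ _]otimes1r otimes_residuum.
Qed.

End ResiduatedLattice.

Section OrderedSet.
Context d (L : completeResiduatedLatticeType d).

Lemma crisp_le_trans (U : lOrderedSet L) (u v w : U) :
  crisp_le u v -> crisp_le v w -> crisp_le u w.
Proof.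
move=> uv vw; apply/eqP; rewrite -le1x.
by apply: le_trans (lle_trans u v w); rewrite uv vw otimes1l.
Qed.

Variable U : completelyLatticeLOrderedSet L.

Lemma lower_cone_le_linf (V : lset L U) u : lower_cone V u <= u ⪯ linf V.
Proof. by have [_ /(cone_top_le u)] := linfP V. Qed.

Lemma upper_cone_le_lsup (V : lset L U) u : upper_cone V u <= lsup V ⪯ u.
Proof. by have [_ /(cone_top_le u)] := lsupP V. Qed.

Lemma linf_lb (V : lset L U) u : V u <= linf V ⪯ u.
Proof. by have [/(cone_top_le u)] := linfP V. Qed.

Lemma lsup_ub (V : lset L U) u : V u <= u ⪯ lsup V.
Proof. by have [/(cone_top_le u)] := lsupP V. Qed.

(** Since [u] lies in [V] to degree [\top], the lower cone at any [w] is bounded by its term at [u],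
    which is [w ⪯ u]. *)
Lemma linf_least (V : lset L U) u :
  V u = \top -> (forall v, V v <= u ⪯ v) -> linf V = u.
Proof.
move=> Vu Vge; apply: is_linf_uniq (linfP V) _; split; apply: cmeet_eq_top => //.
move=> w; exact: (cmeet_residuum_le_top (fun v => w ⪯ v)).
Qed.

Lemma lsup_greatest (V : lset L U) u :
  V u = \top -> (forall v, V v <= v ⪯ u) -> lsup V = u.
Proof.
move=> Vu Vle; apply: is_lsup_uniq (lsupP V) _; split; apply: cmeet_eq_top => //.
move=> w; exact: (cmeet_residuum_le_top (fun v => v ⪯ w)).
Qed.

End OrderedSet.

Section GaloisTolerance.
Context d (L : completeResiduatedLatticeType d).

Lemma galois_lrel_sym (U : lOrderedSet L) (f g : U -> U) :
  isotone_lgalois f g -> lsymmetric (galois_lrel f g).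
Proof. by move=> fg u v; rewrite /galois_lrel !fg -!fg meetC. Qed.

(** Each argument is replaced in the form where no map is applied to it: [u] in [u ⪯ g v], then [v]
    in [f u' ⪯ v]. *)
Lemma lle_galois_compat (U : lOrderedSet L) (f g : U -> U) :
  isotone_lgalois f g ->
  lcompatible (@leqv d L U) (fun u v => f u ⪯ v).
Proof.
move=> fg u u' v v'; have [eqv_refl _ _ _] := leqv_equality U.
apply: (@le_trans _ _ ((f u' ⪯ v) ⊗ (v ≈ v'))).
  apply: le_otimes2r; rewrite !fg.
  by rewrite (le_trans _ (lle_compat u u' (g v) (g v)))// eqv_refl otimes1r.
by rewrite (le_trans _ (lle_compat (f u') (f u') v v'))// eqv_refl otimes1r.
Qed.

Lemma galois_lrel_compat (U : lOrderedSet L) (f g : U -> U) :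
  isotone_lgalois f g -> lcompatible (@leqv d L U) (galois_lrel f g).
Proof.
move=> fg u u' v v'; rewrite /galois_lrel -!fg lexI; apply/andP; split.
  rewrite (le_trans _ (lle_galois_compat fg u u' v v'))//.
  by rewrite !le_otimes2r ?leIl.
(* The second conjunct has the roles of the two pairs exchanged, so the two [≈] factors must be
   commuted. *)
rewrite (le_trans _ (lle_galois_compat fg v v' u u'))//.
rewrite -!otimesA [(v ≈ v') ⊗ _]otimesC.
by apply: le_otimes2r; rewrite leIr.
Qed.

(** For symmetric [R] the left and right images of an L-set agree, so exchanging [A] and [B] only
    exchanges the two conjuncts. *)
Lemma power_rel_sym (X : Type) (R : lrel L X) :
  lsymmetric R -> lsymmetric (power_rel R).
Proof.
move=> Rsym A B; suff RS C : lrel_lset R C = lset_lrel C R.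
  by rewrite /power_rel !RS meetC.
apply/funext => x; rewrite /lrel_lset /lset_lrel.
by under eq_fun do rewrite Rsym otimesC.
Qed.

Variables (U : completelyLatticeLOrderedSet L) (f g : U -> U).

(** If [w] in [B] is related to [x] in [A], then [linf A ⪯ x ⪯ g w], hence [f (linf A) ⪯ w]: so
    [f (linf A)] is a lower bound of [B], to the degree given by the second conjunct. *)
Lemma power_rel_le_linf (A B : lset L U) : isotone_lgalois f g ->
  power_rel (galois_lrel f g) A B <= f (linf A) ⪯ linf B.
Proof.
move=> fg; apply: le_trans (lower_cone_le_linf _ _).
rewrite leIx2 //; apply/orP; right.
apply: subsethood_le_cmeet => w; apply: cjoin_le => x.
rewrite fg; apply: le_trans (lle_trans _ x _).
by apply: le_otimes; [exact: linf_lb | rewrite -fg leIl].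
Qed.

(** Dually, [x] in [A] related to [y] in [B] gives [f x ⪯ y ⪯ lsup B], so [g (lsup B)] bounds [A]
    from above. *)
Lemma power_rel_le_lsup (A B : lset L U) : isotone_lgalois f g ->
  power_rel (galois_lrel f g) A B <= f (lsup A) ⪯ lsup B.
Proof.
move=> fg; rewrite fg; apply: le_trans (upper_cone_le_lsup _ _).
rewrite leIx2 //; apply/orP; left.
apply: subsethood_le_cmeet => x; apply: cjoin_le => y.
rewrite -fg; apply: le_trans (lle_trans _ y _).
by apply: le_otimes; [exact: leIl | exact: lsup_ub].
Qed.

Lemma galois_lrel_complete :
  isotone_lgalois f g -> complete_lrel (galois_lrel f g).
Proof.
move=> fg; have Psym := power_rel_sym (galois_lrel_sym fg).
split=> [|A B|A B]; first exact: galois_lrel_compat.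
  (* By adjunction the second conjunct is the first with [A] and [B] exchanged. *)
  by rewrite lexI -fg power_rel_le_linf//= Psym power_rel_le_linf.
by rewrite lexI -fg power_rel_le_lsup//= Psym power_rel_le_lsup.
Qed.

End GaloisTolerance.

Theorem theorem14 (d : Order.disp_t) (L : completeResiduatedLatticeType d)
    (U : completelyLatticeLOrderedSet L) (f g : U -> U)
    (fg_ext : extensive_lgalois f g) :
  complete_ltolerance (galois_lrel f g) /\
  (forall u : U, tol_inf (galois_lrel f g) u = f u /\
                 tol_sup (galois_lrel f g) u = g u).
Proof.
have [fg ext] := fg_ext.
(* This puts both [f u] and [g u] in the class of [u] to degree [\top], so that the bounds of the
   class are attained. *)
have f_le_g u : (f u ⪯ g u) = \top.
  by have [fu ug] := ext u; exact: crisp_le_trans ug.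
split.
  split; last exact: galois_lrel_complete.
  split; last exact: galois_lrel_sym.
  by move=> u; rewrite /galois_lrel (proj1 (ext u)) (proj2 (ext u)) meetxx.
move=> u; split.
  apply: linf_least => [|v]; last exact: leIl.
  by rewrite /tol_class /galois_lrel lle_refl f_le_g meetxx.
apply: lsup_greatest => [|v]; last exact: leIr.
by rewrite /tol_class /galois_lrel lle_refl f_le_g meetxx.
Qed.
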